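(* Let $D=(E,\mathcal F)$ be a proper set system. Then there exists a feasible set $F\in\mathcal F$ such that $$\omega(D^{\ast\times|F})=\max_{B\subseteq E}\omega(D^{\ast\times|B}).$$
   Context: A set system is a pair $D=(E,\mathcal F)$ with $E$ a finite set and $\mathcal F\subseteq 2^E$; the members of $\mathcal F$ are the feasible sets of $D$, also denoted $\mathcal F(D)$. $D$ is proper if $\mathcal F\neq\emptyset$. For proper $D$, $r(D_{\max})$ and $r(D_{\min})$ denote the largest and smallest cardinality of a feasible set, and the width is $\omega(D)=r(D_{\max})-r(D_{\min})$. Twist: for $A\subseteq E$, $D^{\ast|A}=(E,\{F\triangle A\mid F\in\mathcal F\})$, where $\triangle$ is symmetric difference. Loop complementation: for $e\in E$, $D^{\times|e}=(E,\mathcal F')$ with $\mathcal F'=\mathcal F\,\triangle\,\{F\cup\{e\}\mid F\in\mathcal F,\ e\notin F\}$. Loop complementations on distinct elements commute, and for $A\subseteq E$, $D^{\times|A}$ is obtained by applying loop complementation to every element of $A$. These operations preserve properness. Words are read left to right: $D^{\ast\times|A}=(D^{\ast|A})^{\times|A}$. *)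

(* Defs.v *)
From mathcomp Require Import all_boot.

Set Implicit Arguments.
Unset Strict Implicit.
Unset Printing Implicit Defensive.

(* The ground set is a finType E; a set system on E is given by its family of
   feasible sets. *)
Notation set_system E := {set {set E}}.

Definition symdiff (T : finType) (A B : {set T}) : {set T} :=
  (A :\: B) :|: (B :\: A).

Definition proper_system (E : finType) (D : set_system E) : bool :=
  D != set0.

Definition rmax (E : finType) (D : set_system E) : nat :=
  \max_(F in D) #|F|.

(* The default #|E| bounds the size of every subset of E, so for a proper D
   this is the least size of a feasible set (see rmin_attained, rmin_le). *)
Definition rmin (E : finType) (D : set_system E) : nat :=
  \big[minn/#|E|]_(F in D) #|F|.

(* For a proper D the subtraction does not truncate (see rmin_le_rmax). *)
Definition width (E : finType) (D : set_system E) : nat :=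
  rmax D - rmin D.

Definition twist (E : finType) (D : set_system E) (A : {set E}) :
    set_system E :=
  [set symdiff F A | F in D].

Definition loopc1 (E : finType) (D : set_system E) (e : E) : set_system E :=
  symdiff D [set F :|: [set e] | F in D & e \notin F].

(* The enumeration order is irrelevant: see loopcE. *)
Definition loopc (E : finType) (D : set_system E) (A : {set E}) :
    set_system E :=
  foldl (@loopc1 E) D (enum A).

(* Words are read left to right: first the twist, then the loop
   complementation. *)
Definition twist_loopc (E : finType) (D : set_system E) (A : {set E}) :
    set_system E :=
  loopc (twist D A) A.

Lemma in_symdiff (T : finType) (A B : {set T}) (x : T) :
  (x \in symdiff A B) = (x \in A) (+) (x \in B).
Proof. by rewrite !inE; case: (x \in A); case: (x \in B). Qed.

Lemma in_loopc1 (E : finType) (D : set_system E) (e : E) (X : {set E}) :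
  (X \in loopc1 D e) = (X \in D) (+) ((e \in X) && (X :\ e \in D)).
Proof.
rewrite in_symdiff; congr (_ (+) _).
apply/imsetP/andP => [[F]|[eX XD]].
  rewrite inE => /andP[FD eF] ->; split; first by rewrite !inE eqxx orbT.
  by rewrite setUC setU1K.
by exists (X :\ e); rewrite ?inE ?XD ?eqxx // setUC setD1K.
Qed.

Lemma loopc1C (E : finType) (D : set_system E) (a b : E) :
  loopc1 (loopc1 D a) b = loopc1 (loopc1 D b) a.
Proof.
have [->//|ab] := eqVneq a b.
apply/setP => X; rewrite !in_loopc1 !in_setD1 ab eq_sym ab /=.
have -> : X :\ b :\ a = X :\ a :\ b by rewrite !setDDl setUC.
by case: (X \in D); case: (a \in X); case: (b \in X); case: (X :\ a \in D);
   case: (X :\ b \in D); case: (X :\ a :\ b \in D).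
Qed.

Lemma loopcE (E : finType) (D : set_system E) (A : {set E}) (s : seq E) :
  perm_eq s (enum A) -> loopc D A = foldl (@loopc1 E) D s.
Proof.
rewrite /loopc => sA.
have pull (x : E) s1 s2 D0 : foldl (@loopc1 E) D0 (s1 ++ x :: s2) =
    foldl (@loopc1 E) D0 (x :: s1 ++ s2).
  by elim: s1 D0 => //= y s1 IH D0; rewrite IH /= loopc1C.
elim: {A} (enum A) s D sA => [|x t IH] s D.
  by move/perm_size/size0nil->.
move=> st; have : x \in s by rewrite (perm_mem st) mem_head.
move=> xs; move: st; case/splitPr: xs => s1 s2 st; rewrite pull /=; apply: IH.
by move: st; rewrite perm_catC cat_cons perm_cons perm_catC.
Qed.

Lemma twist_proper (E : finType) (D : set_system E) (A : {set E}) :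
  proper_system D -> proper_system (twist D A).
Proof.
by case/set0Pn=> F FD; apply/set0Pn; exists (symdiff F A); apply: imset_f.
Qed.

Lemma loopc_proper (E : finType) (D : set_system E) (A : {set E}) :
  proper_system D -> proper_system (loopc D A).
Proof.
rewrite /loopc; elim: (enum A) D => //= e s IH D D0; apply: IH.
have [F FD] := set0Pn _ D0; apply/set0Pn.
have [eF|eF] := boolP (e \in F); last by exists F; rewrite in_loopc1 FD (negPf eF).
have [FeD|FeD] := boolP (F :\ e \in D); last first.
  by exists F; rewrite in_loopc1 FD (negPf FeD) andbF.
by exists (F :\ e); rewrite in_loopc1 FeD !inE eqxx.
Qed.

Lemma rmin_le (E : finType) (D : set_system E) (F : {set E}) :
  F \in D -> rmin D <= #|F|.
Proof.
move=> FD; rewrite /rmin.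
elim: (index_enum _) (mem_index_enum F) => //= G s IH.
rewrite big_cons inE => /predU1P[<-|/IH Fs]; first by rewrite FD geq_minl.
by case: ifP => // _; apply: leq_trans Fs; apply: geq_minr.
Qed.

Lemma rmin_attained (E : finType) (D : set_system E) :
  proper_system D -> exists2 F, F \in D & rmin D = #|F|.
Proof.
case/set0Pn=> F0 F0D.
case: (arg_minnP (fun F : {set E} => #|F|) F0D) => F FD Fmin.
exists F => //; apply/eqP; rewrite eqn_leq rmin_le //=.
rewrite /rmin; elim/big_ind: _ => [|m n Fm Fn|G GD]; last exact: Fmin.
  exact: max_card.
by rewrite leq_min Fm.
Qed.

Lemma rmin_le_rmax (E : finType) (D : set_system E) :
  proper_system D -> rmin D <= rmax D.
Proof.
case/rmin_attained=> F FD ->.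
exact: (leq_bigmax_cond (F := fun G : {set E} => #|G|)).
Qed.

(* Main.v *)
Require Import Defs.
From mathcomp Require Import all_boot.

(** Loop complementation preserves the least size of a feasible set, so
    [rmin (twist_loopc D B)] is the distance from [B] to [D]. Passing from [B]
    to [B :|: [set e]] changes [rmax (twist_loopc D B)] by at most one, so that
    [rmax] is 1-Lipschitz in [B] for the Hamming distance. Hence moving a
    maximizer [B] to a nearest feasible set [F], at distance [d], brings [rmin]
    from [d] to [0] and decreases [rmax] by at most [d]. *)

Set Implicit Arguments.
Unset Strict Implicit.
Unset Printing Implicit Defensive.

Lemma symdiffC (T : finType) (A B : {set T}) : symdiff A B = symdiff B A.
Proof. by rewrite /symdiff setUC. Qed.

Lemma symdiffA (T : finType) (A B C : {set T}) :
  symdiff A (symdiff B C) = symdiff (symdiff A B) C.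
Proof. by apply/setP => x; rewrite !in_symdiff addbA. Qed.

Lemma symdiffK (T : finType) (A B : {set T}) : symdiff (symdiff A B) B = A.
Proof. by apply/setP => x; rewrite !in_symdiff addbK. Qed.

Lemma symdiffv (T : finType) (A : {set T}) : symdiff A A = set0.
Proof. by apply/setP => x; rewrite in_symdiff addbb inE. Qed.

Lemma symdiff_eq0 (T : finType) (A B : {set T}) :
  symdiff A B = set0 -> A = B.
Proof.
by move=> AB; rewrite -(symdiffK A B) AB; apply/setP => x; rewrite in_symdiff inE.
Qed.

Section SetSystem.
Variable E : finType.
Implicit Types (D : set_system E) (A B F X Y : {set E}) (e : E).

Lemma in_twist D A X : (X \in twist D A) = (symdiff X A \in D).
Proof.
apply/imsetP/idP => [[F FD ->]|XD]; first by rewrite symdiffK.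
by exists (symdiff X A); rewrite ?symdiffK.
Qed.

Lemma twist_twist D A B : twist (twist D A) B = twist D (symdiff A B).
Proof.
by apply/setP => X; rewrite !in_twist -symdiffA (symdiffC A).
Qed.

(** Operations at different elements act on independent coordinates, hence commute; at the same
    element they do not. *)
Lemma twist1_loopc1 D a e : a != e ->
  twist (loopc1 D a) [set e] = loopc1 (twist D [set e]) a.
Proof.
move=> ae; apply/setP => X; rewrite !(in_twist, in_loopc1).
rewrite in_symdiff inE (negPf ae) addbF.
suff -> : symdiff X [set e] :\ a = symdiff (X :\ a) [set e] by [].
apply/setP => x; rewrite !(in_setD1, in_symdiff) inE.
by have [->|//] := eqVneq x a; rewrite (negPf ae).
Qed.

Lemma foldl_loopc1_rcons D s e :
  foldl (@loopc1 E) (loopc1 D e) s = loopc1 (foldl (@loopc1 E) D s) e.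
Proof. by elim: s D => //= a s IH D; rewrite loopc1C IH. Qed.

Lemma twist1_loopc D A e : e \notin A ->
  twist (loopc D A) [set e] = loopc (twist D [set e]) A.
Proof.
rewrite -mem_enum /loopc; elim: (enum A) D => //= a s IH D.
by rewrite inE negb_or eq_sym => /andP[ae es]; rewrite IH // twist1_loopc1.
Qed.

Lemma loopcU1 D A e : e \notin A -> loopc D (e |: A) = loopc1 (loopc D A) e.
Proof.
move=> eA; rewrite (@loopcE _ _ _ (e :: enum A)) /= ?foldl_loopc1_rcons //.
apply: uniq_perm; rewrite /= ?mem_enum ?eA ?enum_uniq // => x.
by rewrite in_cons !mem_enum in_setU1.
Qed.

(** The twist at [e] slides past the loop complementations on [A], as [e] is not in [A]. So
    enlarging [A] by [e] is a local operation at [e], whatever [A] is. *)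
Lemma twist_loopcU1 D A e : e \notin A ->
  twist_loopc D (e |: A) = loopc1 (twist (twist_loopc D A) [set e]) e.
Proof.
move=> eA; rewrite /twist_loopc loopcU1 // twist1_loopc // twist_twist.
suff -> : e |: A = symdiff A [set e] by [].
apply/setP => x; rewrite in_symdiff !inE.
by have [->|] := eqVneq x e; rewrite ?(negPf eA) ?addbF.
Qed.

Lemma in_loopc1_twist1 D e X :
  (X \in loopc1 (twist D [set e]) e) =
  if e \in X then (X :\ e \in D) (+) (X \in D) else e |: X \in D.
Proof.
rewrite in_loopc1 !in_twist; case: ifP => eX /=; last first.
  rewrite addbF; congr (_ \in D); apply/setP => x; rewrite in_symdiff !inE.
  by have [->|] := eqVneq x e; rewrite ?eX ?addbF.
congr ((_ \in D) (+) (_ \in D)); apply/setP => x; rewrite in_symdiff !inE;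
by have [->|] := eqVneq x e; rewrite ?eX ?addbF.
Qed.

Lemma rmax_leD D D' k :
    (forall X, X \in D -> exists2 Y, Y \in D' & #|X| <= #|Y| + k) ->
  rmax D <= rmax D' + k.
Proof.
move=> DD'; apply/bigmax_leqP => X /DD'[Y YD' /leq_trans->//].
by rewrite leq_add2r (leq_bigmax_cond (F := fun G : {set E} => #|G|)).
Qed.

Lemma rmin_le_rmin D D' :
    (forall X, X \in D' -> exists2 Y, Y \in D & #|Y| <= #|X|) ->
  rmin D <= rmin D'.
Proof.
move=> D'D; rewrite [rmin D']/rmin; elim/big_ind: _ => [|m n Dm Dn|X XD'].
(* The default value [#|E|] bounds [rmin D], since the minimum over [D] starts from it too. *)
- by rewrite /rmin; elim/big_rec: _ => // F n _; rewrite geq_min orbC => ->.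
- by rewrite leq_min Dm.
- by have [Y YD] := D'D X XD'; apply: leq_trans; apply: rmin_le.
Qed.

Lemma rmax_loopc1_twist1_le D e :
  rmax (loopc1 (twist D [set e]) e) <= rmax D + 1.
Proof.
apply: rmax_leD => X; rewrite in_loopc1_twist1; case: ifP => [eX|eX XD].
  have [XD _|_ /= XD] := boolP (X :\ e \in D).
    by exists (X :\ e); rewrite // (cardsD1 e X) eX addnC.
  by exists X; rewrite // leq_addr.
by exists (e |: X); rewrite // cardsU1 eX -addnA addnCA leq_addr.
Qed.

Lemma rmax_le_loopc1_twist1 D e :
  rmax D <= rmax (loopc1 (twist D [set e]) e) + 1.
Proof.
apply: rmax_leD => Y YD; have [eY|eY] := boolP (e \in Y).
  exists (Y :\ e); last by rewrite (cardsD1 e Y) eY addnC.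
  by rewrite in_loopc1_twist1 setD11 setD1K.
(* If [e |: Y] is in [D], then [Y] is feasible in the new system; otherwise the sum modulo 2 of the
   memberships of [Y] and [e |: Y] is 1, so [e |: Y] is. *)
have [YeD|YeD] := boolP (e |: Y \in D).
  by exists Y; rewrite ?leq_addr // in_loopc1_twist1 (negPf eY).
exists (e |: Y); last by rewrite cardsU1 -addnA addnCA leq_addr.
by rewrite in_loopc1_twist1 setU11 setU1K // YD (negPf YeD).
Qed.

(** A set [X] is created or cancelled only when [X :\ e] is in [D]; this smaller set avoids [e], so
    it is feasible before and after. *)
Lemma rmin_loopc1 D e : rmin (loopc1 D e) = rmin D.
Proof.
apply/eqP; rewrite eqn_leq; apply/andP; split; apply: rmin_le_rmin => X XD.
  have [XD'|XD'] := boolP (X \in loopc1 D e); first by exists X.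
  move: XD'; rewrite in_loopc1 XD /= negbK => /andP[_ XeD].
  exists (X :\ e); last exact/subset_leq_card/subD1set.
  by rewrite in_loopc1 XeD setD11.
have [XD'|XD'] := boolP (X \in D); first by exists X.
move: XD; rewrite in_loopc1 (negPf XD') => /andP[_ XeD].
by exists (X :\ e); last exact/subset_leq_card/subD1set.
Qed.

Lemma rmin_loopc D A : rmin (loopc D A) = rmin D.
Proof.
by rewrite /loopc; elim: (enum A) D => //= e s IH D; rewrite IH rmin_loopc1.
Qed.

(** Toggling [e] either inserts or deletes it; deletion is insertion read backwards, which is why
    [rmax] was bounded in both directions. *)
Lemma rmax_twist_loopc_symdiff1 D A e :
  rmax (twist_loopc D A) <= rmax (twist_loopc D (symdiff A [set e])) + 1.
Proof.
have [eA|eA] := boolP (e \in A).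
  have -> : symdiff A [set e] = A :\ e.
    apply/setP => x; rewrite in_symdiff !inE.
    by have [->|] := eqVneq x e; rewrite ?eA ?addbF.
  by rewrite -{1}(setD1K eA) twist_loopcU1 ?setD11 // rmax_loopc1_twist1_le.
have -> : symdiff A [set e] = e |: A.
  apply/setP => x; rewrite in_symdiff !inE.
  by have [->|] := eqVneq x e; rewrite ?(negPf eA) ?addbF.
by rewrite twist_loopcU1 // rmax_le_loopc1_twist1.
Qed.

(** Induction on the Hamming distance: toggling in [A] an element of [symdiff A B] brings [A] one
    step closer to [B]. *)
Lemma rmax_twist_loopc_lipschitz D A B :
  rmax (twist_loopc D A) <= rmax (twist_loopc D B) + #|symdiff A B|.
Proof.
have [n] := ubnP #|symdiff A B|; elim: n A => // n IH A.
have [/symdiff_eq0->|/set0Pn[e eAB]] := eqVneq (symdiff A B) set0.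
  by rewrite leq_addr.
have ABe : symdiff (symdiff A [set e]) B = symdiff A B :\ e.
  apply/setP => x; rewrite in_setD1 !in_symdiff inE.
  have [->|_] := eqVneq x e; last by rewrite addbF.
  by rewrite addbAC -in_symdiff eAB.
rewrite (cardsD1 e) eAB -ABe add1n ltnS => /IH IHA.
apply: leq_trans (rmax_twist_loopc_symdiff1 D A e) _.
by rewrite addn1 addnS ltnS.
Qed.

Lemma rmin_twist_loopc_feasible D F : F \in D -> rmin (twist_loopc D F) = 0.
Proof.
(* Twisting by [F] turns the feasible set [F] into the empty set. *)
move=> FD; rewrite rmin_loopc; apply/eqP; rewrite -leqn0 -(cards0 E).
by rewrite rmin_le // -(symdiffv F) in_twist symdiffK.
Qed.

Lemma rmin_twist_loopc_attained D B : proper_system D ->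
  exists2 F, F \in D & rmin (twist_loopc D B) = #|symdiff F B|.
Proof.
move=> /(twist_proper B)/rmin_attained[X /imsetP[F FD ->] rX].
by exists F; rewrite // rmin_loopc.
Qed.

Lemma width_twist_loopc_le_feasible D B : proper_system D ->
  exists2 F, F \in D & width (twist_loopc D B) <= width (twist_loopc D F).
Proof.
move=> /(rmin_twist_loopc_attained B)[F FD rB]; exists F => //.
(* With [rmin] equal to 0 at [F] and to the distance at [B], the claim becomes the Lipschitz
   bound. *)
rewrite /width (rmin_twist_loopc_feasible FD) subn0 rB leq_subLR addnC symdiffC.
exact: rmax_twist_loopc_lipschitz.
Qed.

End SetSystem.

Theorem theorem3p1 (E : finType) (D : set_system E) (hD : proper_system D) :
  exists F : {set E}, F \in D /\
    width (twist_loopc D F) = \max_(B : {set E}) width (twist_loopc D B).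
Proof.
have [|B maxB] := @eq_bigmax {set E} (fun B => width (twist_loopc D B)).
  by apply/card_gt0P; exists set0.
have [F FD BF] := width_twist_loopc_le_feasible B hD.
exists F; split=> //; apply/eqP; rewrite eqn_leq [X in _ && (X <= _)]maxB BF andbT.
exact: (leq_bigmax (F := fun B => width (twist_loopc D B))).
Qed.
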